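(* For every real $x \in (0,1)$, $$\left(\frac{1}{\cosh x}\right)^{1/2} < \frac{x}{\sinh x} < \left(\frac{1}{\cosh x}\right)^{1/4}.$$ *)

(* Defs.v *)
From Stdlib Require Export Reals.

(* Main.v *)
Require Import Defs.
From Stdlib Require Import Reals Lra.
Open Scope R_scope.

(** Raising to the powers 2 and 4 turns the two inequalities into
    sinh^2 x < x^2 cosh x and x^4 cosh x < sinh^4 x.  Around 0 the leading
    terms of the differences are (1/2 - 1/3) x^4 and (2/3 - 1/2) x^6, both
    positive with room to spare, so on (0,1) crude polynomial bounds suffice:
    [sinh_cosh_lower] gives x + x^3/6 <= sinh x and 1 + x^2/2 <= cosh x, and
    [sinh_cosh_upper] gives sinh x <= x + x^3/5 and cosh x <= 1 + 7x^2/12.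
    With t = x^2 it remains to see that (1 + t/5)^2 < 1 + t/2 and
    1 + 7t/12 < 1 + 2t/3 <= (1 + t/6)^4 for 0 < t < 1.

    Since sinh and cosh are each other's derivative, the polynomial bounds come
    from a constant bound on cosh (at least 1, and at most 2 on [0,1]) by
    integrating repeatedly from 0, which is what [le_of_derive_le] does. *)

(** * Integrating inequalities between sinh, cosh and polynomials *)

Lemma le_of_derive_le (f g f' g' : R -> R) (b : R) :
  (forall x, derivable_pt_lim f x (f' x)) ->
  (forall x, derivable_pt_lim g x (g' x)) ->
  f 0 = g 0 ->
  (forall x, 0 <= x <= b -> f' x <= g' x) ->
  forall x, 0 <= x <= b -> f x <= g x.
Proof.
  intros Df Dg H0 Hle x Hx.
  destruct (Req_dec x 0) as [-> | Hx0]; [lra |].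
  destruct (MVT_cor2 (g - f)%F (fun y => g' y - f' y) 0 x) as [c [Hc Hcx]].
  - lra.
  - intros y _. now apply derivable_pt_lim_minus.
  - unfold minus_fct in Hc.
    assert (f' c <= g' c) by (apply Hle; lra).
    assert (0 <= (g' c - f' c) * (x - 0)) by (apply Rmult_le_pos; lra).
    lra.
Qed.

Lemma derivable_pt_lim_monomial (a : R) (n : nat) (x : R) :
  derivable_pt_lim (fun y => a * y ^ n) x (a * (INR n * x ^ pred n)).
Proof. exact (derivable_pt_lim_scal _ a x _ (derivable_pt_lim_pow x n)). Qed.

Lemma derivable_pt_lim_odd_cubic (c d x : R) :
  derivable_pt_lim (fun y => c * y + d / 3 * y ^ 3) x (c + d * x ^ 2).
Proof.
  replace (c + d * x ^ 2) with (c * 1 + d / 3 * (INR 3 * x ^ pred 3))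
    by (simpl; field).
  apply (derivable_pt_lim_plus (fun y => c * y) (fun y => d / 3 * y ^ 3)).
  - exact (derivable_pt_lim_scal _ c x _ (derivable_pt_lim_id x)).
  - apply derivable_pt_lim_monomial.
Qed.

Lemma derivable_pt_lim_even_quartic (c d x : R) :
  derivable_pt_lim (fun y => 1 + c / 2 * y ^ 2 + d / 4 * y ^ 4) x
    (c * x + d * x ^ 3).
Proof.
  replace (c * x + d * x ^ 3)
    with (0 + c / 2 * (INR 2 * x ^ pred 2) + d / 4 * (INR 4 * x ^ pred 4))
    by (simpl; field).
  apply (derivable_pt_lim_plus (fun y => 1 + c / 2 * y ^ 2)
           (fun y => d / 4 * y ^ 4)).
  - apply (derivable_pt_lim_plus (fun _ => 1) (fun y => c / 2 * y ^ 2)).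
    + apply derivable_pt_lim_const.
    + apply derivable_pt_lim_monomial.
  - apply derivable_pt_lim_monomial.
Qed.

(** The next four lemmas are single integration steps; alternating between
    sinh and cosh raises the degree of a polynomial bound. *)
Lemma sinh_le_of_cosh_le (b c d : R) :
  (forall x, 0 <= x <= b -> cosh x <= c + d * x ^ 2) ->
  forall x, 0 <= x <= b -> sinh x <= c * x + d / 3 * x ^ 3.
Proof.
  intros H.
  apply (le_of_derive_le sinh (fun y => c * y + d / 3 * y ^ 3)
           cosh (fun y => c + d * y ^ 2)); auto.
  - apply derivable_pt_lim_sinh.
  - apply derivable_pt_lim_odd_cubic.
  - rewrite sinh_0. ring.
Qed.

Lemma sinh_ge_of_cosh_ge (b c d : R) :
  (forall x, 0 <= x <= b -> c + d * x ^ 2 <= cosh x) ->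
  forall x, 0 <= x <= b -> c * x + d / 3 * x ^ 3 <= sinh x.
Proof.
  intros H.
  apply (le_of_derive_le (fun y => c * y + d / 3 * y ^ 3) sinh
           (fun y => c + d * y ^ 2) cosh); auto.
  - apply derivable_pt_lim_odd_cubic.
  - apply derivable_pt_lim_sinh.
  - rewrite sinh_0. ring.
Qed.

Lemma cosh_le_of_sinh_le (b c d : R) :
  (forall x, 0 <= x <= b -> sinh x <= c * x + d * x ^ 3) ->
  forall x, 0 <= x <= b -> cosh x <= 1 + c / 2 * x ^ 2 + d / 4 * x ^ 4.
Proof.
  intros H.
  apply (le_of_derive_le cosh (fun y => 1 + c / 2 * y ^ 2 + d / 4 * y ^ 4)
           sinh (fun y => c * y + d * y ^ 3)); auto.
  - apply derivable_pt_lim_cosh.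
  - apply derivable_pt_lim_even_quartic.
  - rewrite cosh_0. ring.
Qed.

Lemma cosh_ge_of_sinh_ge (b c d : R) :
  (forall x, 0 <= x <= b -> c * x + d * x ^ 3 <= sinh x) ->
  forall x, 0 <= x <= b -> 1 + c / 2 * x ^ 2 + d / 4 * x ^ 4 <= cosh x.
Proof.
  intros H.
  apply (le_of_derive_le (fun y => 1 + c / 2 * y ^ 2 + d / 4 * y ^ 4) cosh
           (fun y => c * y + d * y ^ 3) sinh); auto.
  - apply derivable_pt_lim_even_quartic.
  - apply derivable_pt_lim_cosh.
  - rewrite cosh_0. ring.
Qed.

(** * Polynomial bounds for sinh and cosh *)

Lemma one_le_cosh (x : R) : 0 <= x -> 1 <= cosh x.
Proof.
  intros Hx. rewrite <- cosh_0.
  apply (le_of_derive_le (fun _ => cosh 0) cosh (fun _ => 0) sinh x); try lra.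
  - intros y. apply derivable_pt_lim_const.
  - intros y. apply derivable_pt_lim_cosh.
  - intros y [[Hy | <-] _].
    + rewrite <- sinh_0. left. now apply sinh_lt.
    + rewrite sinh_0. lra.
Qed.

Lemma cosh_le_2 (x : R) : 0 <= x <= 1 -> cosh x <= 2.
Proof.
  intros Hx.
  assert (exp x <= 3).
  { apply Rle_trans with (exp 1); [| exact exp_le_3].
    destruct (proj2 Hx) as [H | ->]; [left; now apply exp_increasing | lra]. }
  assert (exp (- x) <= 1).
  { rewrite <- exp_0.
    destruct (proj1 Hx) as [H' | <-]; [left; apply exp_increasing; lra |].
    rewrite Ropp_0. lra. }
  unfold cosh. lra.
Qed.

Lemma sinh_cosh_lower (x : R) :
  0 <= x -> x + x ^ 3 / 6 <= sinh x /\ 1 + x ^ 2 / 2 <= cosh x.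
Proof.
  intros Hx.
  assert (S1 : forall y, 0 <= y <= x -> 1 * y + 0 / 3 * y ^ 3 <= sinh y).
  { apply sinh_ge_of_cosh_ge. intros y Hy.
    pose proof (one_le_cosh y (proj1 Hy)). lra. }
  assert (C2 : forall y, 0 <= y <= x -> 1 + 1 / 2 * y ^ 2 <= cosh y).
  { intros y Hy. pose proof (cosh_ge_of_sinh_ge _ _ _ S1 y Hy). lra. }
  pose proof (sinh_ge_of_cosh_ge _ _ _ C2 x ltac:(lra)).
  pose proof (C2 x ltac:(lra)). lra.
Qed.

(** Each integration step improves the constants, and the bound
    cosh x <= 2 is good enough to start from. *)
Lemma sinh_cosh_upper (x : R) :
  0 <= x <= 1 -> sinh x <= x + x ^ 3 / 5 /\ cosh x <= 1 + 7 / 12 * x ^ 2.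
Proof.
  intros Hx.
  assert (S1 : forall y, 0 <= y <= 1 -> sinh y <= 2 * y + 0 / 3 * y ^ 3).
  { apply sinh_le_of_cosh_le. intros y Hy.
    pose proof (cosh_le_2 y Hy). lra. }
  assert (C2 : forall y, 0 <= y <= 1 -> cosh y <= 1 + 1 * y ^ 2).
  { intros y Hy. pose proof (cosh_le_of_sinh_le _ _ _ S1 y Hy). lra. }
  pose proof (sinh_le_of_cosh_le _ _ _ C2) as S3.
  assert (C4 : forall y, 0 <= y <= 1 -> cosh y <= 1 + 7 / 12 * y ^ 2).
  { intros y Hy. pose proof (cosh_le_of_sinh_le _ _ _ S3 y Hy).
    (* On [0,1] the quartic term y^4/12 is absorbed into y^2/12. *)
    assert (0 <= y ^ 2 <= 1) by nra.
    replace (y ^ 4) with (y ^ 2 * y ^ 2) in * by ring.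
    assert (y ^ 2 * y ^ 2 <= y ^ 2) by nra.
    lra. }
  pose proof (sinh_le_of_cosh_le _ _ _ C4 x Hx).
  pose proof (C4 x Hx). pose proof (pow_le x 3 (proj1 Hx)).
  lra.
Qed.

(** * The two inequalities *)

Lemma sinh_sqr_lt (x : R) : 0 < x < 1 -> sinh x ^ 2 < x ^ 2 * cosh x.
Proof.
  intros Hx.
  destruct (sinh_cosh_upper x ltac:(lra)) as [Su _].
  destruct (sinh_cosh_lower x ltac:(lra)) as [Sl Cl].
  assert (0 < x ^ 2 < 1) by nra.
  assert (0 < x ^ 3) by (apply pow_lt; lra).
  apply Rle_lt_trans with ((x + x ^ 3 / 5) ^ 2).
  - apply pow_incr. lra.
  - apply Rlt_le_trans with (x ^ 2 * (1 + x ^ 2 / 2)).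
    + replace ((x + x ^ 3 / 5) ^ 2) with (x ^ 2 * (1 + x ^ 2 / 5) ^ 2) by field.
      apply Rmult_lt_compat_l; nra.
    + apply Rmult_le_compat_l; lra.
Qed.

Lemma cosh_lt_sinh_pow4 (x : R) : 0 < x < 1 -> x ^ 4 * cosh x < sinh x ^ 4.
Proof.
  intros Hx.
  destruct (sinh_cosh_upper x ltac:(lra)) as [_ Cu].
  destruct (sinh_cosh_lower x ltac:(lra)) as [Sl _].
  assert (0 < x ^ 2) by (apply pow_lt; lra).
  assert (0 < x ^ 3) by (apply pow_lt; lra).
  assert (0 < x ^ 4) by (apply pow_lt; lra).
  apply Rlt_le_trans with ((x + x ^ 3 / 6) ^ 4).
  - replace ((x + x ^ 3 / 6) ^ 4) with (x ^ 4 * (1 + x ^ 2 / 6) ^ 4) by field.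
    apply Rmult_lt_compat_l; [assumption |].
    (* Bernoulli's inequality gives (1 + t/6)^4 >= 1 + 2t/3. *)
    pose proof (poly 4 (x ^ 2 / 6) ltac:(lra)) as B.
    simpl INR in B. lra.
  - apply pow_incr. lra.
Qed.

Lemma Rpower_pow_root (y : R) (n : nat) :
  0 < y -> (0 < n)%nat -> Rpower (y ^ n) (1 / INR n) = y.
Proof.
  intros Hy Hn. apply lt_0_INR in Hn.
  rewrite <- Rpower_pow, Rpower_mult by assumption.
  replace (INR n * (1 / INR n)) with 1 by (field; lra).
  now apply Rpower_1.
Qed.

Theorem theorem1p4 :
  forall x : R, 0 < x < 1 ->
    Rpower (1 / cosh x) (1 / 2) < x / sinh x < Rpower (1 / cosh x) (1 / 4).
Proof.
  intros x Hx.
  assert (Hs : 0 < sinh x) by (rewrite <- sinh_0; apply sinh_lt; lra).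
  assert (Hc : 0 < cosh x) by (pose proof (one_le_cosh x); lra).
  assert (Hq : 0 < x / sinh x) by (apply Rdiv_lt_0_compat; lra).
  split.
  - rewrite <- (Rpower_pow_root (x / sinh x) 2) by (assumption || auto).
    replace (INR 2) with 2 by (simpl; ring).
    apply Rlt_Rpower_l; [lra | split].
    + apply Rdiv_lt_0_compat; lra.
    + apply Rmult_lt_reg_r with (sinh x ^ 2 * cosh x).
      * apply Rmult_lt_0_compat; [now apply pow_lt | assumption].
      * replace (1 / cosh x * (sinh x ^ 2 * cosh x)) with (sinh x ^ 2)
          by (field; lra).
        replace ((x / sinh x) ^ 2 * (sinh x ^ 2 * cosh x))
          with (x ^ 2 * cosh x) by (field; lra).
        now apply sinh_sqr_lt.
  - rewrite <- (Rpower_pow_root (x / sinh x) 4) by (assumption || auto with arith).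
    replace (INR 4) with 4 by (simpl; ring).
    apply Rlt_Rpower_l; [lra | split].
    + now apply pow_lt.
    + apply Rmult_lt_reg_r with (sinh x ^ 4 * cosh x).
      * apply Rmult_lt_0_compat; [now apply pow_lt | assumption].
      * replace (1 / cosh x * (sinh x ^ 4 * cosh x)) with (sinh x ^ 4)
          by (field; lra).
        replace ((x / sinh x) ^ 4 * (sinh x ^ 4 * cosh x))
          with (x ^ 4 * cosh x) by (field; lra).
        now apply cosh_lt_sinh_pow4.
Qed.
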